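(* Let $t\geq 2$ be an integer and let $P$ be a sunflower $t$-pattern. Then $f_t(n,P)=O(n^{t-1})$; that is, there is a constant $a_P$ depending only on $P$ such that $f_t(n,P)\leq a_P\,n^{t-1}$ for all positive integers $n$.
   Context: A $t$-dimensional matrix of size $n_1\times\dots\times n_t$ has entries $M_{i_1,\dots,i_t}$ with $1\le i_r\le n_r$. A submatrix of $M$ of size $m_1\times\dots\times m_t$ is obtained by choosing, for each coordinate $r$, indices $1\le \sigma_r(1)<\dots<\sigma_r(m_r)\le n_r$ and taking $Q_{j_1,\dots,j_t}=M_{\sigma_1(j_1),\dots,\sigma_t(j_t)}$. A $t$-pattern is a $t$-dimensional $0$--$1$ matrix $P$ such that any two entries equal to $1$ have index tuples that are either equal or differ in at least two positions. A $t$-pattern $P$ is a sunflower $t$-pattern if there exist a set $S\subseteq[t]$ (the core) and indices $(c_s)_{s\in S}$ (with $c_s$ in the index range of coordinate $s$ of $P$) such that whenever $P_{i_1,\dots,i_t}=P_{j_1,\dots,j_t}=1$ with $(i_1,\dots,i_t)\neq(j_1,\dots,j_t)$, we have $i_s=j_s=c_s$ for all $s\in S$ and $i_s\neq j_s$ for all $s\notin S$. A $t$-dimensional matrix $M$ avoids a $t$-pattern $P$ if $M$ has no submatrix $Q$ of the same dimensions as $P$ with $P_{i_1,\dots,i_t}\leq Q_{i_1,\dots,i_t}$ for all index tuples. $f_t(n,P)$ denotes the maximum number of entries equal to $1$ in a $t$-dimensional $n\times\dots\times n$ $0$--$1$ matrix avoiding $P$. *)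

(* Defs.v *)
From mathcomp Require Import all_boot.

Set Implicit Arguments.
Unset Strict Implicit.
Unset Printing Implicit Defensive.

(* Coordinates and indices are numbered from 0: coordinate [r : 'I_t] of a
   matrix of size [d] ranges over ['I_(d r)]. *)
Definition index_tuple (t : nat) (d : 'I_t -> nat) : finType :=
  {dffun forall r : 'I_t, 'I_(d r)}.

(* An entry is 1 when it is [true], and [bool] coerces to [nat]. *)
Definition matrix01 (t : nat) (d : 'I_t -> nat) : finType :=
  {ffun index_tuple d -> bool}.

Definition selection (t : nat) (m n : 'I_t -> nat) : finType :=
  {dffun forall r : 'I_t, {ffun 'I_(m r) -> 'I_(n r)}}.

Definition increasing (t : nat) (m n : 'I_t -> nat) (sigma : selection m n) :
    bool :=
  [forall r : 'I_t, forall j : 'I_(m r), forall k : 'I_(m r),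
    (j < k) ==> (sigma r j < sigma r k)].

Definition submatrix (t : nat) (m n : 'I_t -> nat) (M : matrix01 n)
    (sigma : selection m n) : matrix01 m :=
  [ffun j : index_tuple m =>
    M [ffun r : 'I_t => sigma r (j r)]].

Definition is_pattern (t : nat) (d : 'I_t -> nat) (P : matrix01 d) : Prop :=
  forall i j : index_tuple d, P i = true -> P j = true ->
    i = j \/ 2 <= #|[set r : 'I_t | i r != j r]|.

Definition is_sunflower_pattern (t : nat) (d : 'I_t -> nat) (P : matrix01 d) :
    Prop :=
  is_pattern P /\
  exists (S : {set 'I_t}) (c : forall s : 'I_t, s \in S -> 'I_(d s)),
    forall i j : index_tuple d, P i = true -> P j = true -> i <> j ->
      (forall (s : 'I_t) (sS : s \in S), i s = c s sS /\ j s = c s sS) /\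
      (forall s : 'I_t, s \notin S -> i s <> j s).

Definition avoids (t : nat) (m n : 'I_t -> nat) (M : matrix01 n)
    (P : matrix01 m) : bool :=
  ~~ [exists sigma : selection m n, increasing sigma &&
       [forall i : index_tuple m, P i <= submatrix M sigma i]].

Definition weight (t : nat) (d : 'I_t -> nat) (M : matrix01 d) : nat :=
  #|[set i : index_tuple d | M i]|.

(* If no n x ... x n matrix avoids [P] (which requires [P] to have no entry
   equal to 1), this maximum over the empty set is 0. *)
Definition extremal (t n : nat) (m : 'I_t -> nat) (P : matrix01 m) : nat :=
  \max_(M : matrix01 (fun _ : 'I_t => n) | avoids M P) weight M.

(* Main.v *)
Require Import Defs.
From mathcomp Require Import all_boot all_order zify.

(** Choose K at least every side of the pattern and look for a map from the
    grid {0, ..., K - 1}^D into the ones of the matrix which is strictly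
    increasing in each coordinate.  A set of points of {0, ..., n - 1}^d that
    contains no such grid has O(n^(d-1)) elements.  This is the Marcus-Tardos
    argument in the form of Klazar and Marcus: cut the box into blocks of side
    s.  The nonempty blocks are grid-free.  A block whose points take fewer
    than K residues mod s in every direction has at most K^d points.  If a block
    takes at least K residues in direction r, colour it by its layer in
    direction r and its set of residues there; a grid in the d - 1 remaining
    directions among blocks of one colour would lift to a grid of points, so
    induction on d bounds their number.  For s > K^d the resulting recursion
    in n gives the linear bound.

    For a sunflower, fix the coordinates in the core.  A grid in the petal
    directions contains the petals of the pattern, and the core coordinates are
    completed by consecutive layers around the fixed ones, which is possible
    unless the latter are within K of the boundary.  Only O(n^(t-1)) points
    have such a coordinate. *)

Set Implicit Arguments.
Unset Strict Implicit.
Unset Printing Implicit Defensive.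

Section Counting.

Lemma card_fibers (X Y : finType) (f : X -> Y) (A : {set X}) :
  #|A| = \sum_(y in f @: A) #|[set x in A | f x == y]|.
Proof.
rewrite -sum1_card (partition_big_imset f).
by apply: eq_bigr => y _; rewrite sum1dep_card.
Qed.

Lemma leq_card_fibers (X Y : finType) (f : X -> Y) (A : {set X}) (b : nat) :
    (forall x, x \in A -> #|[set z in A | f z == f x]| <= b) ->
  #|A| <= #|f @: A| * b.
Proof.
move=> fibA; rewrite (card_fibers f) -sum_nat_const.
by apply: leq_sum => _ /imsetP[x xA ->]; apply: fibA.
Qed.

Lemma leq_card_bigcup (X J : finType) (D : {set J}) (F : J -> {set X}) :
  #|\bigcup_(j in D) F j| <= \sum_(j in D) #|F j|.
Proof.
elim/big_rec2: _ => [|j k U _ IH]; first by rewrite cards0.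
by apply: leq_trans (leq_card_setU _ _) _; rewrite leq_add2l.
Qed.

Lemma increasing_in_ord_set (n k : nat) (W : {set 'I_n}) : k <= #|W| ->
  exists2 w : 'I_k -> 'I_n, (forall i, w i \in W) & {homo w : i j / i < j}.
Proof.
move=> kW; exists (fun i => Order.enum_val (widen_ord kW i)) => [i|i j].
  exact: Order.enum_valP.
move=> ij; have /Order.POrderTheory.leW_mono lt_val :=
  Order.le_enum_val (@Order.TotalTheory.le_total _ 'I_n) (A := mem W).
by have : (widen_ord kW i < widen_ord kW j)%O by []; rewrite -lt_val.
Qed.

Lemma card_ord_margins (n k : nat) :
  #|[set v : 'I_n | ~~ (k <= v <= n - k)]| <= k.*2.
Proof.
have -> : k.*2 = size (iota 0 k ++ iota (n - k) k).
  by rewrite size_cat !size_iota addnn.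
rewrite cardE -(size_map val); apply: uniq_leq_size.
  by rewrite map_inj_uniq ?enum_uniq //; apply: val_inj.
move=> _ /mapP[v + ->]; rewrite mem_enum inE mem_cat !mem_iota /=.
by have := ltn_ord v; lia.
Qed.

End Counting.

Section Slices.

Variables T Y : finType.
Implicit Types (D : {set T}) (A : {set {ffun T -> Y}}) (z : {ffun T -> Y}).

Definition slice D z : {set {ffun T -> Y}} :=
  [set x : {ffun T -> Y} | [forall r in ~: D, x r == z r]].

Lemma sliceP D z (x : {ffun T -> Y}) :
  reflect (forall r, r \notin D -> x r = z r) (x \in slice D z).
Proof.
rewrite inE; apply: (iffP forall_inP) => xz r rD.
  by apply/eqP/xz; rewrite inE.
by apply/eqP/xz; rewrite inE in rD.
Qed.

Definition proj A (r : T) : {set Y} := [set (x : {ffun T -> Y}) r | x in A].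

Lemma leq_card_prod_proj A : #|A| <= \prod_r #|proj A r|.
Proof.
have /subset_leq_card : A \subset family (fun r => mem (proj A r)).
  by apply/subsetP => x xA; apply/familyP => r; apply: imset_f.
by rewrite card_family foldrE big_map big_enum.
Qed.

Lemma leq_card_slice_proj D z A :
  A \subset slice D z -> #|A| <= \prod_(r in D) #|proj A r|.
Proof.
move=> /subsetP Az; have proj1 r : r \notin D -> #|proj A r| <= 1.
  move=> rD; apply/card_le1_eqP.
  move=> _ _ /imsetP[x /Az/sliceP xz ->] /imsetP[y /Az/sliceP yz ->].
  by rewrite xz ?yz.
apply: leq_trans (leq_card_prod_proj A) _; rewrite (bigID (mem D)) /=.
rewrite -[leqRHS]muln1 leq_mul // (leq_trans (leq_prod proj1)) //.
by rewrite big1.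
Qed.

Lemma leq_card_slices D A (b : nat) :
    (forall z, z \in A -> #|A :&: slice D z| <= b) ->
  #|A| <= #|Y| ^ #|~: D| * b.
Proof.
move=> card_slice.
pose fixed (x : {ffun T -> Y}) := [ffun r : {r | r \in ~: D} => x (val r)].
have card_fixed : #|fixed @: A| <= #|Y| ^ #|~: D|.
  by apply: leq_trans (max_card _) _; rewrite card_ffun card_sig.
apply: leq_trans (leq_mul card_fixed (leqnn b)).
apply: leq_card_fibers => z zA; apply: leq_trans (card_slice z zA).
apply/subset_leq_card/subsetP => x; rewrite !inE => /andP[-> /eqP/ffunP xz].
apply/forall_inP => r rD.
by have := xz (Sub r rD); rewrite !ffunE /= => ->.
Qed.

Lemma card_coord_in (r : T) (V : {set Y}) :
  #|[set x : {ffun T -> Y} | x r \in V]| = #|V| * #|Y| ^ #|T|.-1.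
Proof.
pose F q := if q == r then V else [set: Y].
rewrite (@eq_card _ _ (family (fun q => mem (F q)))) => [|x]; last first.
  rewrite inE; apply/idP/familyP => [xr q|/(_ r)]; rewrite /F ?eqxx //.
  by case: eqVneq => [->|_]; rewrite ?inE.
rewrite card_family foldrE big_map big_enum (bigD1 r) //= /F eqxx.
rewrite -(cardC1 r) -prod_nat_const; congr (_ * _).
by apply: eq_big => // q /negPf ->; rewrite cardsT.
Qed.

End Slices.

Section MapCoords.

Variables (T Y Y' : finType) (g : Y -> Y').

Definition map_coords (x : {ffun T -> Y}) : {ffun T -> Y'} :=
  [ffun r => g (x r)].

Lemma map_coords_slice (D : {set T}) (z : {ffun T -> Y})
    (A : {set {ffun T -> Y}}) :
  A \subset slice D z -> map_coords @: A \subset slice D (map_coords z).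
Proof.
move=> /subsetP Az; apply/subsetP => _ /imsetP[x /Az/sliceP xz ->].
by apply/sliceP => r rD; rewrite !ffunE xz.
Qed.

End MapCoords.

Section Blocks.

Variables (T : finType) (n s : nat).
Implicit Types (D : {set T}) (A : {set {ffun T -> 'I_(n * s)}}).
Implicit Types (y : {ffun T -> 'I_n}) (v w : 'I_(n * s)).

Lemma block_side_gt0 v : 0 < s.
Proof.
have := leq_ltn_trans (leq0n v) (ltn_ord v).
by rewrite muln_gt0 => /andP[].
Qed.

Lemma ord_quo_subproof v : v %/ s < n.
Proof. by rewrite ltn_divLR ?ltn_ord ?(block_side_gt0 v). Qed.

Lemma ord_rem_subproof v : v %% s < s.
Proof. by rewrite ltn_mod (block_side_gt0 v). Qed.

Definition ord_quo v : 'I_n := Ordinal (ord_quo_subproof v).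
Definition ord_rem v : 'I_s := Ordinal (ord_rem_subproof v).

Lemma ord_divE v : v = ord_quo v * s + ord_rem v :> nat.
Proof. exact: divn_eq. Qed.

Lemma ord_quo_homo : {homo ord_quo : v w / v <= w}.
Proof. by move=> v w; apply: leq_div2r. Qed.

Definition block : {ffun T -> 'I_(n * s)} -> {ffun T -> 'I_n} :=
  map_coords ord_quo.

Definition cell A y : {set {ffun T -> 'I_(n * s)}} :=
  [set x in A | block x == y].

Definition residues A y (r : T) : {set 'I_s} := ord_rem @: proj (cell A y) r.

Definition wide_blocks (k : nat) A (r : T) : {set {ffun T -> 'I_n}} :=
  [set y in block @: A | k <= #|residues A y r|].

Lemma cell_quo A y x r : x \in cell A y -> ord_quo (x r) = y r.
Proof. by rewrite inE => /andP[_ /eqP <-]; rewrite ffunE. Qed.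

Lemma card_residues A y r : #|residues A y r| = #|proj (cell A y) r|.
Proof.
apply: card_in_imset => _ _ /imsetP[x xy ->] /imsetP[x' x'y ->] rem_eq.
by apply: val_inj; rewrite /= !ord_divE rem_eq !(cell_quo _ xy, cell_quo _ x'y).
Qed.

Lemma leq_card_cell (k : nat) D z A y : A \subset slice D z ->
  #|cell A y| <=
    k ^ #|D| + \sum_(r in D) (k <= #|residues A y r|) * s ^ #|D|.
Proof.
move=> Az; have cell_box : #|cell A y| <= \prod_(r in D) #|residues A y r|.
  under eq_bigr do rewrite card_residues; apply: (@leq_card_slice_proj _ _ D z).
  by apply: subset_trans Az; apply/subsetP => x; rewrite inE => /andP[].
apply: leq_trans cell_box _.
have [/exists_inP[r rD wide]|/exists_inPn thin] :=
    boolP [exists r in D, k <= #|residues A y r|].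
  rewrite [\sum_(_ in _) _](bigD1 r) //= wide mul1n addnCA -prod_nat_const.
  apply: leq_trans (leq_addr _ _); apply: leq_prod => q _.
  by rewrite -[leqRHS]card_ord max_card.
apply: leq_trans (leq_addr _ _); rewrite -prod_nat_const.
by apply: leq_prod => r rD; rewrite ltnW // ltnNge thin.
Qed.

Lemma leq_card_thin_wide (k : nat) D z A : A \subset slice D z ->
  #|A| <= #|block @: A| * k ^ #|D|
          + (\sum_(r in D) #|wide_blocks k A r|) * s ^ #|D|.
Proof.
move=> Az; rewrite (card_fibers block).
apply: leq_trans; first by apply: leq_sum => y _; exact: (leq_card_cell k y Az).
rewrite big_split /= sum_nat_const leq_add2l exchange_big big_distrl /=.
apply: leq_sum => r _; rewrite -big_distrl leq_mul2r -sum1dep_card.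
by rewrite big_mkcondr leq_sum ?orbT // => y _; case: leqP.
Qed.

End Blocks.

Section GridFreeSets.

Variables (T : finType) (K : nat).
Implicit Types D : {set T}.

(* Images of grid points with equal [r]-coordinates may differ in direction [r].
   Only the directions in [D] are compared, so that the induction can drop a
   direction without changing the ambient type. *)
Definition contains_grid (n : nat) D (A : {set {ffun T -> 'I_n}}) :=
  exists2 e : {ffun T -> 'I_K} -> {ffun T -> 'I_n}, forall i, e i \in A &
    {in D, forall r, {homo e : i j / i r < j r}}.

Lemma contains_grid_map_coords (n n' : nat) (g : 'I_n -> 'I_n') D
    (A : {set {ffun T -> 'I_n}}) :
    {homo g : v w / v <= w} ->
  contains_grid D (map_coords g @: A) -> contains_grid D A.
Proof.
move=> g_homo [e eA e_incr].
have /fin_all_exists2[f fA ef] i : exists2 x, x \in A & e i = map_coords g x.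
  by have /imsetP[x xA ->] := eA i; exists x.
exists f => // r rD i j /(e_incr r rD); rewrite !ef !ffunE.
by rewrite !ltnNge; apply: contraNN => /g_homo.
Qed.

Lemma contains_grid_wide_blocks (n s : nat) D (r : T) (v : 'I_n)
    (W : {set 'I_s}) (A : {set {ffun T -> 'I_(n * s)}})
    (B : {set {ffun T -> 'I_n}}) :
    K <= #|W| ->
    (forall y, y \in B -> y r = v /\ residues A y r = W) ->
  contains_grid (D :\ r) B -> contains_grid D A.
Proof.
move=> KW BvW [e eB e_incr]; have [w wW w_incr] := increasing_in_ord_set KW.
have /fin_all_exists2[f fcell f_rem] i :
    exists2 x, x \in cell A (e i) & ord_rem (x r) = w (i r).
  have := wW (i r); have [_ <-] := BvW _ (eB i).
  by move=> /imsetP[_ /imsetP[x xc ->] ->]; exists x.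
exists f => [i|q qD i j ij].
  by have := fcell i; rewrite inE => /andP[].
have [q_r|qr] := eqVneq q r.
  subst q; rewrite !ord_divE !f_rem !(cell_quo _ (fcell _)).
  by rewrite (BvW _ (eB i)).1 (BvW _ (eB j)).1 ltn_add2l w_incr.
have : e i q < e j q by apply: e_incr; rewrite // !inE qr.
rewrite -!(cell_quo _ (fcell _)) !ltnNge; apply: contraNN.
exact: ord_quo_homo.
Qed.

Definition grid_free_bound (d n b : nat) : Prop :=
  forall D z (A : {set {ffun T -> 'I_n}}), #|D| = d -> A \subset slice D z ->
    ~ contains_grid D A -> #|A| <= b.

Lemma grid_free_bound_line (n : nat) : grid_free_bound 1 n K.
Proof.
move=> D z A /eqP/cards1P[r ->{D}] /subsetP Az gridfree.
rewrite leqNgt; apply/negP => KA; apply: gridfree.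
have coord_inj : {in A &, injective (fun x : {ffun T -> 'I_n} => x r)}.
  move=> x y /Az/sliceP xz /Az/sliceP yz xyr; apply/ffunP => q.
  by have [-> //|qr] := eqVneq q r; rewrite xz ?yz ?inE.
have := ltnW KA; rewrite -(card_in_imset coord_inj).
case/increasing_in_ord_set => w wA w_incr.
have /fin_all_exists2[e eA ew] (i : {ffun T -> 'I_K}) :
    exists2 x, x \in A & x r = w (i r).
  by have /imsetP[x xA ->] := wA (i r); exists x.
exists e => // q /set1P-> i j ij.
by rewrite !ew w_incr.
Qed.

Lemma leq_card_wide_blocks (d n b s : nat) D z (r : T)
    (A : {set {ffun T -> 'I_(n * s)}}) :
    grid_free_bound d n b -> #|D| = d.+1 -> r \in D -> A \subset slice D z ->
    ~ contains_grid D A ->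
  #|wide_blocks K A r| <= n * 2 ^ s * b.
Proof.
move=> bnd cardD rD Az gridfree.
pose colour (y : {ffun T -> 'I_n}) := (y r, residues A y r).
have card_colours : #|colour @: wide_blocks K A r| <= n * 2 ^ s.
  apply: leq_trans (max_card _) _.
  by rewrite card_prod -[#|{set _}|]cardsT -powersetT card_powerset cardsT
             !card_ord.
apply: leq_trans (leq_mul card_colours (leqnn b)).
apply: leq_card_fibers => y0 y0wide; apply: (bnd (D :\ r) y0).
- by move: (cardsD1 r D); rewrite rD cardD => -[].
- have /subsetP Bz := map_coords_slice (@ord_quo n s) Az.
  apply/subsetP => y; rewrite !inE => /andP[/andP[/Bz/sliceP yz _] /eqP[yr _]].
  apply/forall_inP => q; rewrite !inE negb_and negbK => /orP[/eqP->|qD].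
    by rewrite yr.
  move: y0wide; rewrite inE => /andP[/Bz/sliceP y0z _].
  by rewrite yz ?y0z.
apply: contra_not gridfree.
apply: (contains_grid_wide_blocks (v := y0 r) (W := residues A y0 r)).
  by move: y0wide; rewrite inE => /andP[].
by move=> y; rewrite inE => /andP[_ /eqP[-> ->]].
Qed.

Lemma grid_free_bound_blocks (d n s a b : nat) :
    grid_free_bound d n a -> grid_free_bound d.+1 n b ->
  grid_free_bound d.+1 (n * s)
    (b * K ^ d.+1 + d.+1 * (n * 2 ^ s * a) * s ^ d.+1).
Proof.
move=> bnd_d bnd_dS D z A cardD Az gridfree.
apply: leq_trans (leq_card_thin_wide K Az) _; rewrite cardD.
rewrite leq_add // leq_mul2r; apply/orP; right.
  apply: (bnd_dS D _ _ cardD (map_coords_slice _ Az)).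
  by apply: contra_not gridfree; apply/contains_grid_map_coords/ord_quo_homo.
rewrite -cardD -sum_nat_const; apply: leq_sum => r rD.
exact: leq_card_wide_blocks bnd_d cardD rD Az gridfree.
Qed.

Lemma grid_free_bound_pow (d a : nat) :
    (forall n, grid_free_bound d.+1 n (a * n ^ d)) ->
  exists b s, 1 < s /\
    forall k, grid_free_bound d.+2 (s ^ k) (b * (s ^ k) ^ d.+1).
Proof.
move=> bnd; pose s := (K ^ d.+2).+2; pose c := d.+2 * 2 ^ s * a * s ^ d.+2.
exists c.+1, s; split=> //; elim=> [|k IHk].
  move=> D z A _ _ _; apply: leq_trans (max_card _) _.
  by rewrite card_ffun card_ord expn0 !exp1n.
rewrite expnSr; set n := s ^ k in IHk *.
have recursion := grid_free_bound_blocks (s := s) (bnd n) IHk.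
move=> D z A cardD Az gridfree.
apply: leq_trans (recursion D z A cardD Az gridfree) _.
have -> : d.+2 * (n * 2 ^ s * (a * n ^ d)) * s ^ d.+2 = c * n ^ d.+1.
  by rewrite [n ^ d.+1]expnS /c; lia.
apply: (@leq_trans (c.+1 * n ^ d.+1 * s)); first by rewrite /s; nia.
by rewrite expnMn mulnA leq_mul2l -[s in leqLHS]expn1 leq_pexp2l ?orbT.
Qed.

Lemma grid_free_bound_widen (d n n' b : nat) :
  n <= n' -> grid_free_bound d n' b -> grid_free_bound d n b.
Proof.
move=> le_nn' bnd D z A cardD Az gridfree; pose g := widen_ord le_nn'.
have g_inj : injective (map_coords g : {ffun T -> _} -> _).
  move=> x y /ffunP gxy; apply/ffunP => r.
  by apply: val_inj; have /(congr1 val) := gxy r; rewrite !ffunE.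
rewrite -(card_imset _ g_inj).
apply: (bnd D _ _ cardD (map_coords_slice g Az)).
by apply: contra_not gridfree; apply: contains_grid_map_coords.
Qed.

Theorem grid_free_bound_linear (d : nat) :
  exists a, forall n, grid_free_bound d.+1 n (a * n ^ d).
Proof.
elim: d => [|d [a bnd]].
  by exists K => n; rewrite expn0 muln1; apply: grid_free_bound_line.
have [b [s [s_gt1 bnd_pow]]] := grid_free_bound_pow bnd.
exists (b * s ^ d.+1) => n.
have [->|n_gt0] := posnP n.
  move=> D z A cardD _ _; have /card_gt0P[r _] : 0 < #|D| by rewrite cardD.
  by case: (z r).
have /andP[le_pow lt_pow] := trunc_log_bounds s_gt1 n_gt0.
move=> D z A cardD Az gridfree.
have bnd_n := grid_free_bound_widen (ltnW lt_pow) (bnd_pow _).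
apply: leq_trans (bnd_n D z A cardD Az gridfree) _.
rewrite [s ^ _.+1 in leqLHS]expnS expnMn mulnA leq_mul2l.
by rewrite leq_exp2r ?le_pow ?orbT.
Qed.

End GridFreeSets.

Definition interior (T : finType) (n k : nat) (D : {set T}) :
    {set {ffun T -> 'I_n}} :=
  [set x : {ffun T -> 'I_n} | [forall r in D, k <= x r <= n - k]].

Lemma leq_card_setC_interior (T : finType) (n k : nat) (D : {set T}) :
  #|~: interior n k D| <= #|D| * (k.*2 * n ^ #|T|.-1).
Proof.
pose margins := [set v : 'I_n | ~~ (k <= v <= n - k)].
have sub : ~: interior n k D \subset
    \bigcup_(r in D) [set x : {ffun T -> 'I_n} | x r \in margins].
  apply/subsetP => x; rewrite !inE => /forall_inPn[r rD xr].
  by apply/bigcupP; exists r; rewrite // !inE.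
apply: leq_trans (subset_leq_card sub) _.
apply: leq_trans (leq_card_bigcup _ _) _; rewrite -sum_nat_const.
apply: leq_sum => r _; rewrite card_coord_in card_ord leq_mul2r.
by rewrite card_ord_margins orbT.
Qed.

Definition ones (t n : nat) (M : matrix01 (fun _ : 'I_t => n)) :
    {set {ffun 'I_t -> 'I_n}} :=
  [set x : {ffun 'I_t -> 'I_n} | M x].

Lemma weightE (t n : nat) (M : matrix01 (fun _ : 'I_t => n)) :
  weight M = #|ones M|.
Proof.
pose to_tuple (x : {ffun 'I_t -> 'I_n}) : index_tuple (fun _ : 'I_t => n) := x.
rewrite -(@card_imset _ _ to_tuple (ones M)) => [|x y //].
apply: eq_card => x; rewrite inE; apply/idP/imsetP => [xM|[y]].
  by exists x; rewrite ?inE.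
by rewrite inE => yM ->.
Qed.

Definition has_petals (t : nat) (m : 'I_t -> nat) (P : matrix01 m)
    (D : {set 'I_t}) (c : 'I_t -> nat) : Prop :=
  (forall o r, P o -> r \notin D -> o r = c r :> nat) /\
  (forall o o' r, P o -> P o' -> r \in D -> o r = o' r -> o = o').

Lemma sunflower_has_petals (t : nat) (m : 'I_t -> nat) (P : matrix01 m) :
    1 < t -> is_sunflower_pattern P ->
  exists D c, D != set0 /\ has_petals P D c.
Proof.
move=> t_gt1 [pattern [S [c sunflower]]].
have [/existsP[o /existsP[o' /and3P[Po Po' oo']]]|] :=
    boolP [exists o, exists o', [&& P o, P o' & o != o']]; last first.
  (* The sunflower condition is then empty, and [S] may even be all of ['I_t]. *)
  move=> /existsPn P_le1; exists setT, (fun=> 0); split.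
    by rewrite -card_gt0 cardsT card_ord ltnW.
  split=> [o r _|o o' _ Po Po' _ _]; first by rewrite inE.
  apply/eqP; have /existsPn/(_ o') := P_le1 o.
  by rewrite Po Po' negbK.
have core q : P q -> forall r, r \in S -> q r = o r.
  move=> Pq r rS; have [->//|/eqP qo] := eqVneq q o.
  by have [/(_ r rS)[-> ->]] := sunflower _ _ Pq Po qo.
exists (~: S), (fun r => val (o r)); split.
  have [/eqP|] := pattern _ _ Po Po'; first by rewrite (negPf oo').
  move=> /ltnW/card_gt0P[r]; rewrite inE => o_neq_o'; apply/set0Pn; exists r.
  by rewrite inE; apply: contraNN o_neq_o' => rS; rewrite (core o').
split=> [q r Pq|q q' r Pq Pq']; rewrite inE.
  by rewrite negbK => rS; rewrite (core q).
move=> rS qq'; have [//|/eqP ne] := eqVneq q q'.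
by have [_ /(_ r rS)] := sunflower _ _ Pq Pq' ne.
Qed.

Section PetalForm.

Variables (t : nat) (m : 'I_t -> nat) (P : matrix01 m).
Variables (D : {set 'I_t}) (c : 'I_t -> nat).
Hypothesis petalsP : has_petals P D c.

Let K := \max_r m r.

Definition widen_tuple (o : index_tuple m) : {ffun 'I_t -> 'I_K} :=
  [ffun r => widen_ord (leq_bigmax r) (o r)].

(* A layer without a one of [P] still needs an image increasing in [j]: a
   diagonal point of the grid supplies it. *)
Definition layer_point (r : 'I_t) (j : 'I_(m r)) : {ffun 'I_t -> 'I_K} :=
  if [pick o | P o && (o r == j)] is Some o then widen_tuple o
  else [ffun=> widen_ord (leq_bigmax r) j].

Lemma layer_pointE (r : 'I_t) (j : 'I_(m r)) : layer_point j r = j :> nat.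
Proof.
by rewrite /layer_point; case: pickP => [o /andP[_ /eqP <-]|_]; rewrite ffunE.
Qed.

Lemma layer_point_petal (r : 'I_t) (o : index_tuple m) :
  r \in D -> P o -> layer_point (o r) = widen_tuple o.
Proof.
move=> rD Po; rewrite /layer_point.
case: pickP => [o' /andP[Po' /eqP o'r]|/(_ o)]; last by rewrite Po eqxx.
by rewrite (petalsP.2 o' o r).
Qed.

Lemma contains_grid_not_avoids (n : nat) (M : matrix01 (fun _ : 'I_t => n))
    (A : {set {ffun 'I_t -> 'I_n}}) (z : {ffun 'I_t -> 'I_n}) :
    A \subset ones M :&: slice D z -> z \in interior n K (~: D) ->
  contains_grid K D A -> ~~ avoids M P.
Proof.
move=> /subsetP AMz; rewrite inE => /forall_inP zK [e eA e_incr].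
have eAz i : M (e i) /\ forall r, r \notin D -> e i r = z r.
  by have := AMz _ (eA i); rewrite inE => /andP[+ /sliceP]; rewrite inE.
have {}zK r : r \notin D -> K <= z r <= n - K by move=> rD; rewrite zK ?inE.
pose core_ord r (j : 'I_(m r)) : 'I_n := insubd (z r) (z r - c r + j).
have core_ordE r (j : 'I_(m r)) : r \notin D ->
    core_ord r j = z r - c r + j :> nat.
  move=> rD; rewrite val_insubd; case: ifP => // /negP[].
  have := zK r rD; have : m r <= K := leq_bigmax r.
  by have := ltn_ord j; lia.
pose sigma : selection m (fun=> n) := [ffun r => [ffun j : 'I_(m r) =>
  if r \in D then e (layer_point j) r else core_ord r j]].
rewrite negbK; apply/existsP; exists sigma; apply/andP; split.
  apply/forallP => r; apply/'forall_forallP => j k; apply/implyP => jk.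
  rewrite !ffunE; case: ifPn => rD; last by rewrite !core_ordE // ltn_add2l.
  by apply: e_incr; rewrite // !layer_pointE.
apply/forallP => o; rewrite ffunE; case: (boolP (P o)) => // Po.
set x := (X in M X); suff -> : x = e (widen_tuple o) by rewrite (eAz _).1.
apply/ffunP => r; rewrite !ffunE; case: ifPn => rD.
  by rewrite layer_point_petal.
apply: val_inj; rewrite /= core_ordE // (eAz _).2 // -(petalsP.1 o) // subnK //.
have := zK r rD; have : m r <= K := leq_bigmax r.
by have := ltn_ord (o r); lia.
Qed.

Lemma extremal_linear_of_petals : D != set0 ->
  exists a, forall n, extremal n P <= a * n ^ (t - 1).
Proof.
rewrite -card_gt0 => D_gt0.
have [a bnd] := grid_free_bound_linear 'I_t K #|D|.-1.
have dimE : t - 1 = #|~: D| + #|D|.-1.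
  by have := cardsC D; rewrite card_ord; lia.
exists (a + t * K.*2) => n; apply/bigmax_leqP => M avM.
rewrite weightE -(cardsID (interior n K (~: D)) (ones M)) mulnDl leq_add //.
  rewrite dimE expnD mulnCA -[n in n ^ #|~: D|]card_ord.
  apply: leq_card_slices => z; rewrite inE => /andP[_ z_int].
  apply: (bnd n D z); rewrite ?prednK ?subsetIr //.
  have sub_ones := setSI (slice D z) (subsetIl (ones M) (interior n K (~: D))).
  by move=> /(contains_grid_not_avoids sub_ones z_int)/negP.
rewrite setDE; apply: leq_trans (subset_leq_card (subsetIr _ _)) _.
apply: leq_trans (leq_card_setC_interior _ _ _) _.
by rewrite card_ord subn1 -mulnA leq_mul2r -[leqRHS]card_ord max_card orbT.
Qed.

End PetalForm.

Theorem theorem1 (t : nat) (ht : 2 <= t) (m : 'I_t -> nat) (P : matrix01 m)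
    (hP : is_sunflower_pattern P) :
  exists a : nat, forall n : nat, 0 < n -> extremal n P <= a * n ^ (t - 1).
Proof.
have [D [c [D_neq0 petalsP]]] := sunflower_has_petals ht hP.
have [a extremal_le] := extremal_linear_of_petals petalsP D_neq0.
by exists a.
Qed.
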